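(* Let $\Omega$ be a nonempty open subset of $\mathbb{C}$. Let $\mathcal{S}_p$ be the set of sequences $(f_n)\in H(\Omega)^{\mathbb{N}}$ that converge to $0$ pointwise on $\Omega$, and let $\mathcal{S}_{uc}$ be the set of sequences $(f_n)\in H(\Omega)^{\mathbb{N}}$ that converge to $0$ uniformly on every compact subset of $\Omega$. Then the set $\mathcal{S}_p\setminus\mathcal{S}_{uc}$ is strongly $\mathfrak{c}$-algebrable (as a subset of the commutative algebra $H(\Omega)^{\mathbb{N}}$).
   Context: $H(\Omega)$ is the complex vector space of all holomorphic functions on $\Omega$ (which is not assumed connected). $H(\Omega)^{\mathbb{N}}$ is the set of all sequences of holomorphic functions on $\Omega$; with termwise sum, termwise multiplication by complex scalars, and termwise product $(f_n)\cdot(g_n)=(f_n g_n)$ it is a commutative complex algebra. $\mathfrak{c}$ is the cardinality of the continuum. For a cardinal $\alpha$, a subset $A$ of a commutative complex algebra is called strongly $\alpha$-algebrable if there is an $\alpha$-generated free algebra $\mathcal{M}$ with $\mathcal{M}\setminus\{0\}\subset A$; that is, there is a subset $B$ of the algebra, of cardinality $\alpha$, such that for every positive integer $N$, every nonzero complex polynomial $P$ in $N$ variables without constant term, and all distinct elements $z_1,\ldots,z_N\in B$, one has $P(z_1,\ldots,z_N)\in A\setminus\{0\}$. *)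

(* Defs.v *)
From HB Require Import structures.
From mathcomp Require Import all_boot all_order all_algebra.
From mathcomp Require Import all_classical all_reals all_analysis.
From mathcomp.real_closed Require Import complex.
From mathcomp Require Import -(notations) mpoly.

Set Implicit Arguments.
Unset Strict Implicit.
Unset Printing Implicit Defensive.

Import Order.TTheory GRing.Theory Num.Theory numFieldNormedType.Exports.

Local Open Scope classical_set_scope.
Local Open Scope ring_scope.

(* The topology and norm of MathComp-Analysis are attached to coercions from
   abstract number structures and are not found on the bare type R[i], hence
   this packing. *)
Definition Cplx (R : realType) : numClosedFieldType := R[i].

Section FunctionAlgebra.
Context (T : pointedType) (K : pzRingType) (A : comAlgType K).

Fact fct_scalerAl (a : K) (f g : T -> A) : a *: (f * g) = (a *: f) * g.
Proof. by apply/funext => t; exact: scalerAl. Qed.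

HB.instance Definition _ :=
  GRing.Lmodule_isLalgebra.Build K (T -> A) fct_scalerAl.

Fact fct_scalerAr (a : K) (f g : T -> A) : a *: (f * g) = f * (a *: g).
Proof. by apply/funext => t; exact: scalerAr. Qed.

HB.instance Definition _ :=
  GRing.Lalgebra_isAlgebra.Build K (T -> A) fct_scalerAr.

End FunctionAlgebra.

Record nonempty_open (R : realType) := NonemptyOpen {
  nonempty_open_set :> set (Cplx R);
  nonempty_open_open : open nonempty_open_set;
  nonempty_open_neq0 : nonempty_open_set !=set0
}.

Section Holomorphic.
Context (R : realType) (Omega : nonempty_open R).

(* A function on Omega is extended by 0 in order to speak of its complex
   derivative; as Omega is open, the values of the extension outside Omega are
   irrelevant. *)
Definition holomorphic : {pred (Omega -> Cplx R)} :=
  [pred f : Omega -> Cplx R | `[< forall x : Omega,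
     derivable (valL_ (0 : Cplx R) f : Cplx R -> Cplx R) (set_val x) 1 >]].

Let valL_in (f : Omega -> Cplx R) (y : Cplx R)
    (Oy : y \in (Omega : set (Cplx R))) :
  valL_ (0 : Cplx R) f y = f (exist _ y Oy).
Proof. by rewrite /valL_ oinv_set_val /= insubT. Qed.

Let nearO (P : Cplx R -> Prop) (x : Omega) :
  (forall y, y \in (Omega : set (Cplx R)) -> P y) ->
  \forall y \near set_val x, P y.
Proof.
move=> PO; have Ox : (Omega : set (Cplx R)) (set_val x) by exact/set_mem/valP.
have : nbhs (set_val x) (Omega : set (Cplx R)).
  by apply: open_nbhs_nbhs; split => //; exact: nonempty_open_open.
by apply: filterS => y /mem_set; exact: PO.
Qed.

Fact holomorphic_subring_closed : subring_closed holomorphic.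
Proof.
split=> [|f g /asboolP hf /asboolP hg|f g /asboolP hf /asboolP hg];
  apply/asboolP => x.
- apply: (near_eq_derivable (f := cst (1 : Cplx R))); last exact: derivable_cst.
  by apply: nearO => y Oy; rewrite (valL_in _ Oy).
- apply: near_eq_derivable; last exact: (derivableB (hf x) (hg x)).
  by apply: nearO => y Oy; rewrite !fctE !(valL_in _ Oy).
- apply: near_eq_derivable; last exact: (derivableM (hf x) (hg x)).
  by apply: nearO => y Oy; rewrite !fctE !(valL_in _ Oy).
Qed.

HB.instance Definition _ :=
  GRing.isSubringClosed.Build _ holomorphic holomorphic_subring_closed.

Fact holomorphic_scaler_closed : GRing.scaler_closed holomorphic.
Proof.
move=> a f /asboolP hf; apply/asboolP => x.
apply: near_eq_derivable; last exact: (@derivableZ _ _ _ _ a _ _ (hf x)).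
by apply: nearO => y Oy;
  rewrite (valL_in (a *: f) Oy) /= -[RHS]/(a *: f _) -(valL_in f Oy).
Qed.

HB.instance Definition _ :=
  GRing.isScaleClosed.Build _ _ holomorphic holomorphic_scaler_closed.

Record holo := Holo {
  holo_fun :> Omega -> Cplx R;
  holo_funP : holo_fun \in holomorphic
}.

HB.instance Definition _ := [isSub for holo_fun].
HB.instance Definition _ := [Choice of holo by <:].
HB.instance Definition _ :=
  GRing.SubChoice_isSubComPzRing.Build _ _ holo holomorphic_subring_closed.
HB.instance Definition _ := [SubZmodule_isSubLmodule of holo by <:].

Fact holo_oner_neq0 : 1 != 0 :> holo.
Proof.
have [x Ox] := nonempty_open_neq0 Omega.
apply/eqP => /(congr1 (fun f : holo => f (exist _ x (mem_set Ox)))) /eqP.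
by rewrite oner_eq0.
Qed.

HB.instance Definition _ :=
  GRing.PzSemiRing_isNonZero.Build holo holo_oner_neq0.

Fact holo_scalerAl (a : Cplx R) (f g : holo) : a *: (f * g) = (a *: f) * g.
Proof. by apply/val_inj/funext => x; exact: mulrA. Qed.

HB.instance Definition _ :=
  GRing.Lmodule_isLalgebra.Build (Cplx R) holo holo_scalerAl.

Fact holo_scalerAr (a : Cplx R) (f g : holo) : a *: (f * g) = f * (a *: g).
Proof. by rewrite mulrC scalerAl mulrC. Qed.

HB.instance Definition _ :=
  GRing.Lalgebra_isAlgebra.Build (Cplx R) holo holo_scalerAr.

End Holomorphic.

(* D is any set whose cardinality is the prescribed cardinal; card_eq means that
   there is a bijection. *)
Definition strongly_algebrable (K : fieldType) (A : comAlgType K)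
    (T : Type) (D : set T) (S : set A) : Prop :=
  exists2 B : set A, (B #= D)%card &
    forall (N : nat) (P : mpoly N K) (z : 'I_N -> A),
      (0 < N)%N -> P != 0 -> mcoeff mnm0 P = 0 ->
      injective z -> (forall i, B (z i)) ->
      (S `\` [set 0]) (mmap (GRing.in_alg A) z P).

Definition pointwise_null (R : realType) (Omega : nonempty_open R) :
    set (nat -> holo Omega) :=
  [set f | forall x : Omega, f n x @[n --> \oo] --> (0 : Cplx R)].

(* The compact sets are taken in Omega with its subspace topology: these are
   the compact subsets of the plane that are included in Omega. *)
Definition compactly_null (R : realType) (Omega : nonempty_open R) :
    set (nat -> holo Omega) :=
  [set f | {family compact, (fun n => f n : Omega -> Cplx R) @ \oo -->
              (cst 0 : Omega -> Cplx R)}].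

Arguments pointwise_null [R] Omega _.
Arguments compactly_null [R] Omega _.

(* Main.v *)
(** There are polynomials f_n tending to 0 pointwise and points x_n tending to
a point of Omega with f_n(x_n) = 1. Given real sequences s_t with values in [0,
1], indexed by the reals t, put z_t = (s_t(n) f_n)_n. A polynomial P in
finitely many z_t is pointwise null when P(0) = 0, and its n-th term takes at
x_n the value P(s_t1(n), ..., s_tN(n)). The s_t are chosen independent: every
tuple of values 1/(c_i + 1), with c_i natural numbers, is attained for
infinitely many n; for one such tuple P does not vanish, and this prevents
uniform convergence on the compact set made of the x_n and their limit.

For the peaks f_n one takes, around the origin, x_n = 1/n and normalises at x_n
a polynomial roughly inverse to z - x_n - i/n^2: its size is n^2 at x_n but at
most n at the points of the disc of radius n that are off the strip 0 < Re z <
2/n, and every point of the plane is eventually such. The polynomial is found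
by Runge's method, moving the pole from x_n + i/n^2 upwards until it is far
away. *)

From HB Require Import structures.
Require Import Defs.
From mathcomp Require Import all_boot all_order all_algebra.
From mathcomp Require Import all_classical all_reals all_analysis.
From mathcomp Require Import -(notations) mpoly.
From mathcomp Require Import ring lra.
From mathcomp.real_closed Require Import complex.

Set Implicit Arguments.
Unset Strict Implicit.
Unset Printing Implicit Defensive.

Import Order.TTheory GRing.Theory Num.Theory numFieldNormedType.Exports.

Local Open Scope classical_set_scope.
Local Open Scope ring_scope.

(** * Nonvanishing of polynomials at reciprocals of natural numbers *)

Lemma digits_inj (D N : nat) (f g : 'I_N -> nat) :
  (forall i, f i < D)%N -> (forall i, g i < D)%N ->
  (\sum_i f i * D ^ i = \sum_i g i * D ^ i)%N -> f =1 g.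
Proof.
elim: N f g => [|N IHN] f g fD gD; first by move=> _ [].
have shift (h : 'I_N.+1 -> nat) : (\sum_i h i * D ^ i =
    h ord0 + (\sum_(i < N) h (lift ord0 i) * D ^ i) * D)%N.
  rewrite big_ord_recl expn0 muln1 big_distrl /=; congr (_ + _)%N.
  by apply: eq_bigr => i _; rewrite /bump /= add1n expnSr mulnA.
have D_gt0 : (0 < D)%N by apply: leq_ltn_trans (fD ord0).
rewrite !shift => eqfg.
have eq0 : f ord0 = g ord0.
  move: (congr1 (modn^~ D) eqfg).
  by rewrite !(addnC _ (_ * D)%N) !modnMDl !modn_small.
have eqS : (fun i => f (lift ord0 i)) =1 (fun i => g (lift ord0 i)).
  apply: IHN => // ; apply/eqP; rewrite -(eqn_pmul2r D_gt0).
  by move/eqP: eqfg; rewrite eq0 eqn_add2l.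
by move=> i; case: (unliftP ord0 i) => [j|] ->.
Qed.

(* Kronecker substitution X_i := t ^ (D ^ i), with D larger than all exponents,
   turns P into a nonzero polynomial in t. *)
Lemma meval_neq0_inv_nat (K : numFieldType) (N : nat) (P : mpoly N K) :
  P != 0 -> exists c : 'I_N -> nat, meval (fun i => (c i).+1%:R^-1) P != 0.
Proof.
move=> P0; pose D := msize P.
pose wt (m : multinom N) := (\sum_i m i * D ^ i)%N.
pose p : {poly K} := \sum_(m <- msupp P) mcoeff m P *: 'X^(wt m).
have small m i : m \in msupp P -> (m i < D)%N.
  move=> /msize_mdeg_lt; apply: leq_ltn_trans.
  by rewrite mdegE (bigD1 i) //= leq_addr.
have evP t : meval (fun i : 'I_N => t ^+ (D ^ i)) P = p.[t].
  rewrite mevalE horner_sum; apply: eq_bigr => m _.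
  rewrite hornerZ hornerXn; congr (_ * _).
  rewrite /wt expr_sum; apply: eq_bigr => i _.
  by rewrite -exprM mulnC.
have [m0 m0P] : exists m, m \in msupp P.
  case E : (msupp P) => [|m s]; last by exists m; rewrite inE eqxx.
  by move/eqP: E; rewrite msupp_eq0 (negPf P0).
(* Distinct monomials of [P] have distinct weights, by uniqueness of base [D] digits, so the
   coefficient of [m0] survives in [p]. *)
have p0 : p != 0.
  apply/eqP => /(congr1 (fun q : {poly K} => q`_(wt m0))).
  rewrite coef0 coef_sum (bigD1_seq m0) ?msupp_uniq //=.
  rewrite coefZ coefXn eqxx mulr1 big_seq_cond big1 ?addr0.
    by apply/eqP; rewrite -mcoeff_msupp.
  move=> m /andP[mP mm0]; rewrite coefZ coefXn.
  case: eqP => [e|]; last by rewrite mulr0.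
  case/eqP: mm0; apply/mnmP; apply: (@digits_inj D N) => [i|i|].
  - exact: small.
  - exact: small.
  - exact: esym e.
pose t (k : nat) : K := k.+1%:R^-1.
have tinj : injective t by move=> j k /invr_inj /eqP; rewrite eqr_nat => /eqP[].
have [k tk] : exists k, ~~ root p (t k).
  apply/not_existsP => allroot.
  have : (size [seq t k | k <- iota 0 (size p)] < size p)%N.
    apply: max_poly_roots => //; last by rewrite map_inj_uniq ?iota_uniq.
    by apply/allP => _ /mapP[k _ ->]; apply/negP => /negP /(allroot k).
  by rewrite size_map size_iota ltnn.
(* The predecessor cancels the successor in the statement. *)
exists (fun i => (k.+1 ^ (D ^ i)).-1)%N.
rewrite (@meval_eq _ _ _ (fun i : 'I_N => t k ^+ (D ^ i))).
  by rewrite evP.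
by move=> i; rewrite prednK ?expn_gt0 // natrX exprVn.
Qed.

(** * Independent sequences indexed by real numbers *)

Lemma nth_interpolation (N : nat) (t c : 'I_N -> nat) : injective t ->
  exists L : seq nat, forall i, nth 0%N L (t i) = c i.
Proof.
move=> tinj.
exists (mkseq (fun k => if [pick i | t i == k] is Some i then c i else 0)%N
  (\max_i t i).+1) => i.
rewrite nth_mkseq ?ltnS ?leq_bigmax //.
by case: pickP => [j /eqP/tinj ->|/(_ i)]; rewrite ?eqxx.
Qed.

(** Once [m] exceeds every [|a i - a j|^-1], the numbers [m * a i] are more than 1 apart, whereas
    numbers with equal floors are less than 1 apart. *)
Lemma floor_separation (R : archiRealFieldType) (N : nat) (a : 'I_N -> R) :
  injective a -> exists m : nat, injective (fun i => Num.floor (m%:R * a i)).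
Proof.
move=> ainj.
pose bnd (u : 'I_N * 'I_N) := Num.bound (`|a u.1 - a u.2|^-1).
pose m := (\max_u bnd u)%N.
exists m => i j eqf; apply: contrapT => nij.
have d0 : 0 < `|a i - a j|.
  by rewrite normr_gt0 subr_eq0; apply/eqP => /ainj.
have : 1 < m%:R * `|a i - a j|.
  rewrite -ltr_pdivrMr // div1r.
  apply: lt_le_trans (archi_boundP _) _; first by rewrite invr_ge0 ltW.
  by rewrite ler_nat; apply: (@leq_bigmax _ bnd (i, j)).
have m0 : 0 <= m%:R :> R by [].
rewrite -(ger0_norm m0) -normrM ltNge => /negP; apply.
rewrite mulrBr ler_norml.
have [] := (floor_le (m%:R * a i), floorD1_gt (m%:R * a i)).
have [] := (floor_le (m%:R * a j), floorD1_gt (m%:R * a j)).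
rewrite eqf !intrD; lra.
Qed.

(* An index n encodes a precision m and a table L of prescribed values; the
   sequence of a reads the table at the rank of the integer part of m a. The
   unused component makes every pair (m, L) occur for infinitely many n. *)
Definition lookup (R : archiRealFieldType) (a : R) (n : nat) : nat :=
  if (unpickle n : option (nat * nat * seq nat)) is Some (_, m, L) then
    nth 0%N L (pickle (Num.floor (m%:R * a)))
  else 0%N.

Lemma lookup_independent (R : archiRealFieldType) (N : nat) (a : 'I_N -> R)
    (c : 'I_N -> nat) (n0 : nat) : injective a ->
  exists2 n, (n0 <= n)%N & forall i, lookup (a i) n = c i.
Proof.
move=> ainj; have [m minj] := floor_separation ainj.
have [|L Lc] := @nth_interpolation _
  (fun i => pickle (Num.floor (m%:R * a i))) c.
  by move=> i j /(pcan_inj pickleK) /minj.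
pose code (k : nat) := pickle (k, m, L).
have code_inj : injective code by move=> j k /(pcan_inj pickleK) [].
(* Pigeonhole: [n0.+1] distinct codes cannot all be below [n0]. *)
have [k n0k] : exists k, (n0 <= code k)%N.
  apply/not_existsP => small.
  have /(uniq_leq_size _) :
      {subset [seq code k | k <- iota 0 n0.+1] <= iota 0 n0}.
    move=> _ /mapP[k _ ->]; rewrite mem_iota /= add0n ltnNge.
    exact/negP/small.
  by rewrite map_inj_uniq ?iota_uniq // size_map !size_iota ltnn => /(_ isT).
by exists (code k) => // i; rewrite /lookup pickleK Lc.
Qed.

(** * Pole pushing and the peak polynomials *)

Section PolePushing.
Context (C : numClosedFieldType) (K : set C).
Implicit Types (a b : C).

(* The polynomial p is a rough inverse of z - a on K. *)
Definition pole_removable a :=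
  exists p : {poly C}, forall z, K z -> `|1 - (z - a) * p.[z]| <= 4^-1.

(** For a distant pole the constant [- a^-1] will do, the error being z / a. *)
Lemma pole_removable_far a :
  (forall z, K z -> 4 * `|z| <= `|a|) -> a != 0 -> pole_removable a.
Proof.
move=> Ka a0; exists (- a^-1)%:P => z Kz; rewrite hornerC.
have -> : 1 - (z - a) * - a^-1 = z / a.
  by rewrite mulrN opprK mulrBl divff // addrC subrK.
rewrite normrM normfV ler_pdivrMr ?normr_gt0 //.
by rewrite -ler_pdivrMl ?invr_gt0 // invrK Ka.
Qed.

(* If e = 1 - (z - b) p(z) has modulus at most 1/2, then 1 - e ^ 2 is a multiple
   of z - b. *)
Lemma pole_removable_push a b :
  (forall z, K z -> 5 * `|b - a| <= `|z - a|) ->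
  pole_removable a -> pole_removable b.
Proof.
move=> Kab [p pa]; exists (p * (2%:P - ('X - b%:P) * p)) => z Kz.
rewrite !(hornerM, hornerD, hornerN, hornerX, hornerC).
set e := 1 - (z - b) * p.[z].
have -> : 1 - (z - b) * (p.[z] * (2 - (z - b) * p.[z])) = e * e.
  by rewrite /e; ring.
(* [e] is the old error, at most 1/4, plus (b - a) p(z), at most a fifth of |(z - a) p(z)| <= 5/4.
   Squaring 1/2 restores the bound 1/4. *)
have e_le : `|e| <= 2^-1.
  have -> : e = (1 - (z - a) * p.[z]) + (b - a) * p.[z] by rewrite /e; ring.
  have pz : `|(z - a) * p.[z]| <= 5 * 4^-1.
    rewrite -[X in `|X|](subKr 1); apply: le_trans (ler_normB _ _) _.
    rewrite normr1 (_ : 5 * 4^-1 = 1 + 4^-1 :> C) ?lerD2l ?pa //.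
    by field.
  have pb : 5 * `|(b - a) * p.[z]| <= `|(z - a) * p.[z]|.
    by rewrite !normrM mulrA ler_wpM2r ?Kab.
  have {}pb : `|(b - a) * p.[z]| <= 4^-1.
    by rewrite -(ler_pM2l (x := 5)) //; apply: le_trans pb pz.
  apply: le_trans (ler_normD _ _) _.
  by rewrite (_ : 2^-1 = 4^-1 + 4^-1 :> C) ?lerD ?pa //; field.
rewrite normrM (_ : 4^-1 = 2^-1 * 2^-1 :> C); first exact: ler_pM.
by field.
Qed.

End PolePushing.

Lemma peak_polynomial (C : numClosedFieldType) (n : nat) : (0 < n)%N ->
  exists q : {poly C}, q.[n%:R^-1] = 1 /\
    forall w, `|w| <= n%:R -> n%:R^-1 <= `|'Re w - n%:R^-1| ->
      `|q.[w]| <= 2 / n%:R.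
Proof.
move=> n0; have nC : 0 < n%:R :> C by rewrite ltr0n.
have n1 : 1 <= n%:R :> C by rewrite ler1n.
set x : C := n%:R^-1.
have x0 : 0 < x by rewrite invr_gt0.
have x1 : x <= 1 by rewrite invf_le1.
pose K := [set w : C | w = x \/ (`|w| <= n%:R /\ x <= `|'Re w - x|)].
(* The poles climb by x^2/5 because [pole_removable_push] allows a fifth of the distance to [K],
   which is at least x^2 by [far] below. *)
pose h (j : nat) : C := x ^+ 2 * (1 + j%:R / 5).
pose pole j : C := x + 'i * h j.
have h0 j : x ^+ 2 <= h j.
  by rewrite ler_pMr ?exprn_gt0 // lerDl divr_ge0.
have hge0 j : 0 <= h j by apply: le_trans (h0 j); rewrite exprn_ge0 // ltW.
have normih j : `|'i * h j| = h j.
  by rewrite normrM normCi mul1r ger0_norm.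
have xx : x ^+ 2 <= x by rewrite expr2 ler_piMl // ltW.
have Re_pole w j : 'Re (w - pole j) = 'Re w - x.
  by rewrite raddfB /= /pole Re_rect // ger0_real // ltW.
(* At x the distance is the height of the pole; off the strip the horizontal distance alone is at
   least x >= x^2. *)
have far w j : K w -> x ^+ 2 <= `|w - pole j|.
  case=> [->|[_ xw]].
    by rewrite /pole opprD addNKr normrN normih.
  apply: le_trans xx _; apply: le_trans xw _.
  by rewrite -(Re_pole w j) (leif_normC_Re_Creal _).1.
have step j : pole_removable K (pole j.+1) -> pole_removable K (pole j).
  apply: pole_removable_push => w Kw.
  have -> : pole j - pole j.+1 = - ('i * (x ^+ 2 / 5)).
    by rewrite /pole /h -natr1; field.
  rewrite normrN normrM normCi mul1r ger0_norm; last first.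
    by rewrite divr_ge0 // exprn_ge0 // ltW.
  by rewrite mulrC divfK // far.
(* As x = 1/n, 25 n^3 steps of x^2/5 climb 5n. The modulus of the pole is then at least 4n, while
   [K] lies in the disc of radius n. *)
have top : pole_removable K (pole (25 * n ^ 3)%N).
  have large : 5 * n%:R <= h (25 * n ^ 3)%N.
    have -> : h (25 * n ^ 3)%N = x ^+ 2 + 5 * n%:R.
      by rewrite /h natrM natrX /x; field; rewrite gt_eqF.
    by rewrite lerDr exprn_ge0 // ltW.
  have normpole : 4 * n%:R <= `|pole (25 * n ^ 3)%N|.
    rewrite /pole addrC; apply: le_trans (lerB_normD _ _).
    rewrite normih (ger0_norm (ltW x0)) lerBrDr; apply: le_trans large.
    rewrite (_ : 5 = 4 + 1 :> C); last by ring.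
    by rewrite [leRHS]mulrDl mul1r lerD2l (le_trans x1).
  apply: pole_removable_far => [w Kw|]; last first.
    by rewrite -normr_gt0 (lt_le_trans _ normpole) // mulr_gt0.
  apply: le_trans normpole; rewrite ler_pM2l //.
  by case: Kw => [->|[]//]; rewrite (ger0_norm (ltW x0)) (le_trans x1).
have [p pK] : pole_removable K (pole 0%N).
  by elim: (25 * n ^ 3)%N top => // j IHj /step.
have norm0 : `|x - pole 0%N| = x ^+ 2.
  by rewrite /pole opprD addNKr normrN normih /h mul0r addr0 mulr1.
have px : 3 / 4 <= x ^+ 2 * `|p.[x]|.
  rewrite -norm0 -normrM -[X in `|X|](subKr 1).
  apply: le_trans (lerB_dist _ _); rewrite normr1.
  rewrite (_ : 3 / 4 = 1 - 4^-1 :> C) ?lerD2l ?lerN2; last by field.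
  by apply: pK; left.
have px0 : 0 < `|p.[x]|.
  rewrite -(pmulr_rgt0 _ (exprn_gt0 2 x0)); apply: lt_le_trans px.
  by rewrite divr_gt0.
exists (p * (p.[x]^-1)%:P); split=> [|w wn xw]; rewrite hornerM hornerC.
  by rewrite divff // -normr_gt0.
rewrite normrM normfV ler_pdivrMr // -(ler_pM2l x0).
have -> : x * (2 / n%:R * `|p.[x]|) = 2 * (x ^+ 2 * `|p.[x]|).
  by rewrite -/x; ring.
have wK : K w by right.
(* The chain is x |p(w)| <= |(w - pole 0) p(w)| <= 5/4 <= 2 (3/4) <= 2 x^2 |p(x)|. *)
apply: (@le_trans _ _ (1 + 4^-1)).
  apply: (@le_trans _ _ `|(w - pole 0%N) * p.[w]|).
    rewrite normrM ler_wpM2r //; apply: le_trans xw _.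
    by rewrite -(Re_pole w 0%N) (leif_normC_Re_Creal _).1.
  rewrite -[X in `|X|](subKr 1); apply: le_trans (ler_normB _ _) _.
  by rewrite normr1 lerD2l pK.
apply: (@le_trans _ _ (2 * (3 / 4))); last by rewrite ler_pM2l.
rewrite (_ : 2 * (3 / 4) = 1 + (4^-1 + 4^-1) :> C); last by field.
by rewrite lerD2l lerDl.
Qed.

(** * Polynomial evaluation, compactness and bounds *)

Lemma meval0_mcoeff (K : comNzRingType) (N : nat) (P : mpoly N K) :
  meval (fun=> 0) P = mcoeff mnm0 P.
Proof.
rewrite [P in LHS]mpolyE [P in RHS]mpolyE !raddf_sum /=.
apply: eq_bigr => m _; rewrite mevalZ mcoeffZ mevalX mcoeffX; congr (_ * _).
have [->|m0] := eqVneq m mnm0.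
  by rewrite big1 // => i _; rewrite mnm0E expr0.
have [i mi] : exists i, m i != 0%N.
  apply/existsP; apply: contraNT m0; rewrite negb_exists => /forallP m0.
  by apply/eqP/mnmP => i; rewrite mnm0E; apply/eqP; rewrite -[_ == _]negbK m0.
by rewrite (bigD1 i) //= expr0n (negPf mi) mul0r.
Qed.

Lemma rmorph_mmap (K : fieldType) (A : comAlgType K) (phi : {rmorphism A -> K})
    (N : nat) (P : mpoly N K) (z : 'I_N -> A) : (forall c, phi c%:A = c) ->
  phi (mmap (GRing.in_alg A) z P) = meval (fun i => phi (z i)) P.
Proof.
move=> phiA; rewrite rmorph_sum; apply: eq_bigr => m _.
rewrite rmorphM phiA; congr (_ * _).
by rewrite rmorph_prod; apply: eq_bigr => i _; rewrite rmorphXn.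
Qed.

Lemma cvg_meval (K : numFieldType) (T : Type) (F : set_system T) (N : nat)
    (P : mpoly N K) (v : T -> 'I_N -> K) (l : 'I_N -> K) : Filter F ->
  (forall i, v t i @[t --> F] --> l i) ->
  meval (v t) P @[t --> F] --> meval l P.
Proof.
move=> FF vl; rewrite mevalE; under eq_fun do rewrite mevalE.
apply: cvg_big => [|m _]; first exact: add_continuous.
apply: cvgMl_tmp; apply: cvg_big => [|i _]; first exact: mul_continuous.
elim: (m i) => [|k IHk]; first by under eq_fun do rewrite expr0; exact: cvg_cst.
by under eq_fun do rewrite exprS; rewrite exprS; apply: cvgM.
Qed.

(** If a filter does not cluster at [l], one of its sets misses a neighbourhood of [l], hence a tail
    of [u]. The filter then lives on finitely many terms, which form a compact set. *)
Lemma compact_cvg_seq (T : topologicalType) (u : nat -> T) (l : T) :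
  u @ \oo --> l -> compact (l |` range u).
Proof.
move=> ul F FF FK.
have [lF|] := pselect (cluster F l); first by exists l => //; split=> //; left.
move=> /existsNP[A /existsNP[U /not_implyP[FA /not_implyP[Ul AU0]]]].
have [M _ uU] := ul _ Ul.
have FuM : F (u @` `I_M).
  apply: filterS (filterI FK FA) => _ [[->|[n _ <-]] Ax].
    by case: AU0; exists l; split=> //; exact: nbhs_singleton.
  exists n => //=; rewrite ltnNge; apply/negP => Mn.
  by case: AU0; exists (u n); split=> //; exact: uU.
have [x [[n _ <-] Fx]] := finite_compact (finite_image u (finite_II M)) FF FuM.
by exists (u n); split=> //; right; exists n.
Qed.

Lemma cplx_nat_bound (R : realType) (z : Cplx R) : exists n : nat, `|z| <= n%:R.
Proof.
have [n zn] : exists n : nat, complex.Re `|z| <= n%:R.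
  exists (Num.bound (complex.Re `|z|)).
  by apply/ltW/archi_boundP; rewrite -(@lecR R); exact: (normr_ge0 z).
exists n; have -> : `|z| = (complex.Re `|z|)%:C%C by [].
by rewrite -(rmorph_nat (real_complex R)) lecR.
Qed.

(** * Peaks inside Omega *)

Section Peaks.
Context (R : realType) (Omega : nonempty_open R).
Local Notation C := (Cplx R).

Lemma valL_inE (f : Omega -> C) (x : Omega) : valL_ (0 : C) f (set_val x) = f x.
Proof.
rewrite /valL_ oinv_set_val /= insubT; first exact: valP.
by move=> Ox; congr f; exact: val_inj.
Qed.

Lemma near_set_val (P : C -> Prop) (x : Omega) :
  (forall y : Omega, P (set_val y)) -> \forall y \near set_val x, P y.
Proof.
move=> PO; apply: (@filterS _ (nbhs (set_val x)) _ (Omega : set C)).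
  by move=> y /mem_set Oy; exact: (PO (exist _ y Oy)).
by apply: open_nbhs_nbhs; split; [exact: nonempty_open_open|exact/set_mem/valP].
Qed.

Lemma holomorphic_shift (a : C) :
  (fun x : Omega => set_val x - a) \in holomorphic (Omega := Omega).
Proof.
apply/asboolP => x; apply: (@near_eq_derivable _ _ _ (fun y : C => y - a)).
  by apply: near_set_val => y; rewrite valL_inE.
apply: derivableB; [exact: derivable_id|exact: derivable_cst].
Qed.

Lemma holomorphic_horner (a : C) (q : {poly C}) :
  (fun x : Omega => q.[set_val x - a]) \in holomorphic (Omega := Omega).
Proof.
elim/poly_ind: q => [|q c IHq].
  rewrite (_ : (fun=> _) = 0) ?rpred0 //.
  by apply/funext => x; rewrite horner0.
(* The Horner step is carried out in the algebra [holo], so its result is holomorphic by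
   construction. *)
pose f := Holo IHq * Holo (holomorphic_shift a) + c *: (1 : holo Omega).
suff -> : (fun x : Omega => (q * 'X + c%:P).[set_val x - a]) = f.
  exact: holo_funP.
apply/funext => x; rewrite hornerMXaddC -[c in LHS]mulr1.
reflexivity.
Qed.

Lemma cvg_invn : (n.+1%:R^-1 : C) @[n --> \oo] --> (0 : C).
Proof.
apply/cvgrPdist_lt => e e0; have [N Ne] := cplx_nat_bound e^-1.
near=> n; rewrite sub0r normrN ger0_norm ?invr_ge0 // invf_plt ?posrE //.
move: Ne; rewrite ger0_norm ?invr_ge0 ?(ltW e0) // => /le_lt_trans -> //.
by rewrite ltr_nat ltnS; near: n; exact: nbhs_infty_ge.
Unshelve. all: by end_near. Qed.

Lemma set_type_cvg (x : nat -> Omega) (a : Omega) :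
  set_val (x n) @[n --> \oo] --> (set_val a : C) -> x @ \oo --> a.
Proof.
by move=> xa A /= [_ [[B Bop <-] Ba BA]]; apply: filterS BA _; apply: xa;
  apply: open_nbhs_nbhs; split.
Qed.

Lemma peak_sequence :
  exists (f : nat -> holo Omega) (x : nat -> Omega) (a : Omega),
  [/\ pointwise_null Omega f, x @ \oo --> a & forall n, f n (x n) = 1].
Proof.
have [a Oa] := nonempty_open_neq0 Omega.
pose q n := projT1 (cid (peak_polynomial C (ltn0Sn n))).
have qP n : (q n).[n.+1%:R^-1] = 1 /\ forall w, `|w| <= n.+1%:R ->
    n.+1%:R^-1 <= `|'Re w - n.+1%:R^-1| -> `|(q n).[w]| <= 2 / n.+1%:R.
  by rewrite /q; case: cid.
have invS_lt (e : C) : 0 < e -> \forall n \near \oo, n.+1%:R^-1 * 2 < e.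
  move=> e0; have e20 : 0 < e / 2 by rewrite divr_gt0.
  have /cvgrPdist_lt /(_ _ e20) := cvg_invn; apply: filterS => n.
  by rewrite sub0r normrN ger0_norm ?invr_ge0 // ltr_pdivlMr.
have q_null w : (q n).[w] @[n --> \oo] --> (0 : C).
  apply/cvgrPdist_lt => e e0; have [N wN] := cplx_nat_bound w.
  (* If Re w <= 0, then w is outside every strip; otherwise it is outside once 2/(n+1) < Re w. *)
  have Re_far : \forall n \near \oo, n.+1%:R^-1 <= `|'Re w - n.+1%:R^-1|.
    have [y0|y0] := real_leP (Creal_Re w) (real0 C).
      near=> n; rewrite distrC ger0_norm ?subr_ge0 ?lerDl ?oppr_ge0 //.
      by rewrite (le_trans y0) // invr_ge0.
    near=> n; apply: le_trans (real_ler_norm _); last first.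
      by rewrite realB ?Creal_Re // ger0_real // invr_ge0.
    rewrite lerBrDr -mulr2n -[_ *+ 2]mulr_natr; apply: ltW.
    by near: n; exact: invS_lt.
  near=> n; rewrite sub0r normrN; apply: le_lt_trans ((qP n).2 w _ _) _.
  - apply: le_trans wN _; rewrite ler_nat ltnW // ltnS.
    by near: n; exact: nbhs_infty_ge.
  - by near: n.
  - by rewrite mulrC; near: n; exact: invS_lt.
have aS : (a + n.+1%:R^-1 : C) @[n --> \oo] --> a.
  rewrite -[X in _ --> X]addr0.
  by apply: cvgD; [exact: cvg_cst|exact: cvg_invn].
(* Omega being open, it contains a + 1/(n+1) from some rank on; both the points and the peaks are
   shifted by that rank. *)
have [n0 xO] : exists n0 : nat,
    forall n, (Omega : set C) (a + (n + n0).+1%:R^-1).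
  have nbhsO : open_nbhs a (Omega : set C).
    by split => //; exact: nonempty_open_open.
  have [n0 _ n0O] := aS _ (open_nbhs_nbhs nbhsO).
  by exists n0 => n; apply: n0O; rewrite /= leq_addl.
pose x n : Omega := SigSub (mem_set (xO n)).
exists (fun n => Holo (holomorphic_horner a (q (n + n0)%N))), x,
  (SigSub (mem_set Oa)).
split.
- move=> y /=; have := q_null (set_val y - a).
  by rewrite -(cvg_shiftn n0).
- apply: set_type_cvg => /=.
  by have := aS; rewrite -(cvg_shiftn n0).
- by move=> n; rewrite /= addrC addKr; have [] := qP (n + n0)%N.
Unshelve. all: by end_near. Qed.

End Peaks.

(** * Point evaluations and failure of uniform convergence *)

Section PointEvaluation.
Context (R : realType) (Omega : nonempty_open R) (n : nat) (x : Omega).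

(** Named so as to carry the ring morphism structure that [rmorph_mmap] expects. *)
Definition point_eval (F : nat -> holo Omega) : Cplx R := F n x.

Fact point_eval_zmod : zmod_morphism point_eval. Proof. by []. Qed.
Fact point_eval_monoid : monoid_morphism point_eval. Proof. by []. Qed.

HB.instance Definition _ :=
  GRing.isZmodMorphism.Build _ _ point_eval point_eval_zmod.
HB.instance Definition _ :=
  GRing.isMonoidMorphism.Build _ _ point_eval point_eval_monoid.

Lemma mmap_point_eval (N : nat) (P : mpoly N (Cplx R))
    (z : 'I_N -> nat -> holo Omega) :
  (mmap (GRing.in_alg (nat -> holo Omega)) z P n : holo Omega) x =
  meval (fun i => z i n x) P.
Proof.
by rewrite -[LHS]/(point_eval _) rmorph_mmap // => c; exact: mulr1.
Qed.

End PointEvaluation.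

Lemma not_compactly_null (R : realType) (Omega : nonempty_open R)
    (F : nat -> holo Omega) (x : nat -> Omega) (a : Omega) (e : Cplx R) :
  x @ \oo --> a -> 0 < e ->
  (forall n0, exists2 n, (n0 <= n)%N & e <= `|F n (x n)|) ->
  ~ compactly_null Omega F.
Proof.
move=> xa e0 Fx Fnull.
have FK := (fam_cvgP compact _ _).1 Fnull _ (compact_cvg_seq xa).
(* The functions of modulus less than [e] on the compact set form a uniform neighbourhood of 0,
   which [F n] leaves for arbitrarily large [n]. *)
have [] := FK _ [set h : Omega -> Cplx R |
                  forall y, (a |` range x) y -> `|h y| < e].
  apply/uniform_nbhs; exists [set uv : Cplx R * Cplx R | ball uv.1 e uv.2].
  split; first by rewrite -entourage_ballE; exists e.
  move=> h he y /he; rewrite /= -ball_normE /=.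
  by rewrite sub0r normrN.
move=> M _ FM; have [n Mn] := Fx M; apply/negP.
rewrite -real_ltNge ?normr_real ?gtr0_real //.
by apply: (FM n Mn); right; exists n.
Qed.

(** * The generators z_t and their algebra *)

Theorem theorem3p1 (R : realType) (Omega : nonempty_open R) :
  strongly_algebrable [set: R]
    (pointwise_null Omega `\` compactly_null Omega).
Proof.
have [f [x [a [f0 xa fx]]]] := peak_sequence Omega.
pose z (t : R) n := ((lookup t n).+1%:R^-1 : Cplx R) *: f n.
have zx t n : z t n (x n) = (lookup t n).+1%:R^-1.
  by rewrite -[LHS]/(_ * f n (x n)) fx mulr1.
have z0 t : pointwise_null Omega (z t).
  move=> y; apply/cvgrPdist_lt => e e0.
  have /cvgrPdist_lt /(_ e e0) := f0 y; apply: filterS => n.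
  rewrite !sub0r !normrN; apply: le_lt_trans.
  rewrite -[z t n y]/(_ * f n y) normrM ler_piMl //.
  by rewrite ger0_norm ?invr_ge0 // invf_le1 // ler1n.
(* This gives [range z] the cardinality of the reals. Two distinct parameters read 0 and 1 at a
   common index, where the values at the peak are 1 and 1/2. *)
have zinj : injective z.
  move=> s t zst; apply: contrapT => st.
  have inj2 : injective (fun i : 'I_2 => if i == ord0 then s else t).
    by move=> [[|[|//]] i] [[|[|//]] j] //= E; apply: val_inj => //=;
      case: st.
  have [n _ nE] := lookup_independent (fun i : 'I_2 => val i) 0 inj2.
  have : z s n (x n) = z t n (x n) by rewrite zst.
  rewrite !zx => /invr_inj/eqP; rewrite eqr_nat.
  by have /= -> := nE ord0; have /= -> := nE (lift ord0 ord0).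
exists (range z); first by apply: inj_card_eq => s t _ _; exact: zinj.
move=> N P w N0 P0 Pc winj wz.
have /choice[t wt] : forall i, exists s, z s = w i.
  by move=> i; have [s _ <-] := wz i; exists s.
have tinj : injective t by move=> i j tij; apply: winj; rewrite -!wt tij.
have [c Pcn0] := meval_neq0_inv_nat P0.
have peaks n0 : exists2 n, (n0 <= n)%N &
    (mmap (GRing.in_alg (nat -> holo Omega)) w P n : holo Omega) (x n) =
    meval (fun i => (c i).+1%:R^-1) P.
  have [n n0n nc] := lookup_independent c n0 tinj.
  exists n => //; rewrite mmap_point_eval; apply: meval_eq => i.
  by rewrite -wt zx nc.
split; last first.
  move=> /= P0z; have [n _] := peaks 0%N; rewrite P0z => /esym/eqP.
  by rewrite (negPf Pcn0).
split.
  move=> y; under eq_fun do rewrite mmap_point_eval.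
  (* The limit is written as P(0), the constant term, so that continuity of [P] applies. *)
  rewrite -Pc -meval0_mcoeff; apply: cvg_meval => i.
  by rewrite -wt; exact: z0.
apply: (not_compactly_null xa (e := `|meval (fun i => (c i).+1%:R^-1) P|)).
  by rewrite normr_gt0.
by move=> n0; have [n n0n nE] := peaks n0; exists n => //; rewrite nE.
Qed.
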